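(* Let $a,b$ be distinct relatively prime positive integers, one of which is even. If $a$ is even, then the Ulam sequence $\mathcal{U}(a,b)$ has at least $1+a/2$ even terms; if $b$ is even, then $\mathcal{U}(a,b)$ has at least $1+b/2$ even terms.
   Context: For distinct positive integers $a,b$, the Ulam sequence $\mathcal{U}(a,b)$ is the increasing sequence whose first two terms are $a$ and $b$ and in which each subsequent term is the smallest integer larger than all previous terms that can be written as the sum of two distinct earlier terms in exactly one way (unordered pairs). *)

(* Defs.v *)
From mathcomp Require Import all_boot.

Set Implicit Arguments.
Unset Strict Implicit.
Unset Printing Implicit Defensive.

(* Number of unordered pairs of distinct terms among u 0, ..., u n.-1 with sum
   m. Pairs are indexed by positions i < j; as Ulam sequences are strictly
   increasing, distinct positions carry distinct terms. *)
Definition num_reps (u : nat -> nat) (n m : nat) : nat :=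
  #|[set p : 'I_n * 'I_n | (p.1 < p.2) && (u p.1 + u p.2 == m)]|.

Definition ulam_candidate (u : nat -> nat) (n m : nat) : Prop :=
  (forall k, k < n -> u k < m) /\ num_reps u n m = 1.

(* The sequence is increasing, so a and b are listed in increasing order
   whichever of them is the smaller: U(a,b) = U(b,a). *)
Definition is_ulam (a b : nat) (u : nat -> nat) : Prop :=
  [/\ u 0 = minn a b,
      u 1 = maxn a b
    & forall n, 2 <= n ->
        ulam_candidate u n (u n) /\
        (forall m, ulam_candidate u n m -> u n <= m)].

Definition at_least_even_terms (u : nat -> nat) (k : nat) : Prop :=
  exists N, k <= #|[set i : 'I_N | ~~ odd (u i)]|.

Lemma eq_num_reps u v n m :
  (forall k, k < n -> u k = v k) -> num_reps u n m = num_reps v n m.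
Proof.
move=> uv; rewrite /num_reps; congr #|pred_of_set _|.
by apply/setP=> p; rewrite !inE !uv.
Qed.

(* The sum of the last two terms always has a unique representation, hence the
   sequence never stops. *)
Lemma num_reps_last2 u n :
  (forall i j, i < j -> j < n.+2 -> u i < u j) ->
  num_reps u n.+2 (u n + u n.+1) = 1.
Proof.
move=> inc.
have le_inc i j : i <= j -> j < n.+2 -> u i <= u j.
  by rewrite leq_eqVlt => /orP[/eqP-> // | ij jn]; exact/ltnW/inc.
pose p0 : 'I_n.+2 * 'I_n.+2 := (inord n, ord_max).
rewrite /num_reps; apply/eqP/cards1P; exists p0; apply/setP=> -[i j].
rewrite !inE /= xpair_eqE -!val_eqE /= inordK //.
apply/andP/andP=> [[ij /eqP s] | [/eqP-> /eqP->]]; last by rewrite ltnSn eqxx.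
have jn : j <= n.+1 by rewrite -ltnS.
have i_n : i <= n by rewrite -ltnS (leq_trans ij).
have ui := le_inc i n i_n (leqnSn _); have uj := le_inc j n.+1 jn (leqnn _).
have /eqP ej : val j == n.+1.
  case: (ltngtP j n.+1) jn => // lj _.
  have := inc _ _ lj (leqnn _) => uj'.
  by have := leq_add ui uj'; rewrite addnS s ltnn.
split; last exact/eqP.
case: (ltngtP i n) i_n => // li _.
have ui' := inc _ _ li (leqnSn _).
by have := leq_add ui' uj; rewrite addSn s ltnn.
Qed.

Lemma is_ulam_exists (a b : nat) (ha : 0 < a) (hb : 0 < b) (hab : a <> b) :
  exists u, is_ulam a b u.
Proof.
pose P (s : seq nat) m :=
  all (fun x => x < m) s && (num_reps (nth 0 s) (size s) m == 1).
pose next s := find (P s) (iota 0 (sumn s).+1).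
pose U := fix U n := if n is n'.+1 then rcons (U n') (next (U n'))
                     else [:: minn a b; maxn a b].
have sU n : size (U n) = n.+2 by elim: n => //= n IH; rewrite size_rcons IH.
have PP s m : reflect (ulam_candidate (nth 0 s) (size s) m) (P s m).
  apply: (iffP andP) => [[/all_nthP h /eqP] | [h /eqP]]; split=> //.
    by move=> k; exact: h.
  by apply/(all_nthP 0).
have nextP s : (exists2 m, m <= sumn s & P s m) ->
    P s (next s) /\ (forall m, P s m -> next s <= m).
  case=> m0 m0s Pm0.
  have hs : has (P s) (iota 0 (sumn s).+1).
    by apply/hasP; exists m0 => //; rewrite mem_iota.
  have hl : next s < (sumn s).+1 by move: hs; rewrite has_find size_iota.
  split; first by have := nth_find 0 hs; rewrite nth_iota.
  move=> m Pm; rewrite leqNgt; apply/negP=> lt.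
  have := before_find 0 lt; rewrite nth_iota ?(ltn_trans lt) //.
  by rewrite add0n Pm.
have incP n : (forall k, k < n.+2 -> 0 < nth 0 (U n) k) /\
    (forall i j, i < j -> j < n.+2 -> nth 0 (U n) i < nth 0 (U n) j) /\
    (exists2 m, m <= sumn (U n) & P (U n) m).
  have ex k : (forall k', k' < k.+2 -> 0 < nth 0 (U k) k') ->
     (forall i j, i < j -> j < k.+2 -> nth 0 (U k) i < nth 0 (U k) j) ->
     (exists2 m, m <= sumn (U k) & P (U k) m).
    move=> pos inc; exists (nth 0 (U k) k + nth 0 (U k) k.+1).
      rewrite -[X in sumn X](cat_take_drop k) sumn_cat.
      rewrite (drop_nth 0) ?sU // (drop_nth 0) ?sU //=.
      by apply: leq_trans (leq_addl _ _); rewrite addnA leq_addr.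
    apply/PP; rewrite sU; split; last exact: num_reps_last2.
    move=> i; rewrite ltnS leq_eqVlt => /orP[/eqP-> | ik].
      by rewrite -[X in X < _]add0n ltn_add2r pos.
    by rewrite ltn_addl // inc.
  elim: n => [|n [pos [inc /nextP[/PP[]]]]].
    have pos : forall k', k' < 2 -> 0 < nth 0 (U 0) k'.
      by move=> [|[|//]] _ /=; rewrite ?leq_min ?leq_max ha ?hb.
    have inc i j : i < j -> j < 2 -> nth 0 (U 0) i < nth 0 (U 0) j.
      case: i j => [|i] [|[|j]] //= _ _.
      by case: (ltngtP a b) hab => // ->.
    by split=> //; split=> //; exact: ex.
  rewrite sU => gt _ _.
  have pos' k : k < n.+3 -> 0 < nth 0 (U n.+1) k.
    rewrite /= nth_rcons sU ltnS leq_eqVlt => /orP[/eqP->|kn].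
      by rewrite ltnn eqxx (leq_ltn_trans _ (gt 0 isT)).
    by rewrite kn pos.
  have inc' i j : i < j -> j < n.+3 -> nth 0 (U n.+1) i < nth 0 (U n.+1) j.
    move=> ij; rewrite /= !nth_rcons sU ltnS leq_eqVlt => /orP[/eqP ej|jn].
      by move: ij; rewrite ej => ij; rewrite ij ltnn eqxx gt.
    by rewrite (ltn_trans ij jn) jn inc.
  by split=> //; split=> //; exact: ex.
pose u n := nth 0 (U n) n.
have stable n d k : k < n.+2 -> nth 0 (U (d + n)) k = nth 0 (U n) k.
  move=> kn; elim: d => //= d IH.
  by rewrite nth_rcons sU IH (leq_trans kn) // !ltnS leq_addl.
have uE n k : k < n.+2 -> u k = nth 0 (U n) k.
  rewrite ltnS leq_eqVlt => /orP[/eqP-> | kn].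
    by rewrite /u -(stable n 1).
  by rewrite /u -(stable k (n - k)) // subnK // -ltnS.
exists u; split=> // -[|[|n]] // _.
have [_ [_ /nextP[/PP + least]]] := incP n; rewrite sU.
have -> : u n.+2 = next (U n) by rewrite (uE n.+1) //= nth_rcons sU ltnn eqxx.
have cand m : ulam_candidate u n.+2 m <-> ulam_candidate (nth 0 (U n)) n.+2 m.
  rewrite /ulam_candidate (@eq_num_reps u (nth 0 (U n))); last exact: uE.
  by split=> -[h ?]; split=> // k kn; have := h k kn; rewrite (uE n k kn).
move=> /cand h; split=> // m /cand hm; apply: least; apply/PP.
by rewrite sU.
Qed.

(* Main.v *)
(* The numbers a + n b with 0 <= n <= a all belong to U(a,b); those with n even
   are 1 + a/2 even terms when a is even. Every term is of the form x a + y b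
   with x, y >= 0, and as a and b are coprime, a value determines (x, y) up to
   multiples of (b, -a). Hence no y b with 2 <= y < a, and no x a with
   2 <= x < b, is a term, and neither is a b when a, b > 1; so the only
   decomposition of a + n b into two distinct terms is b + (a + (n-1) b). If
   b = 1 this holds because all the other terms are at least a, and two distinct
   ones add up to more than 2 a. *)
Require Import Defs.
From mathcomp Require Import all_boot zify.

Set Implicit Arguments.
Unset Strict Implicit.
Unset Printing Implicit Defensive.

Definition is_term (u : nat -> nat) (m : nat) : Prop := exists n, u n = m.

Lemma is_ulam_sym a b u : is_ulam a b u -> is_ulam b a u.
Proof. by rewrite /is_ulam minnC maxnC. Qed.

(** This is used with [x] and [y] the differences of coefficients in two expressions of one value.
    Subtraction on [nat] truncates, so each use takes the differences in the direction where both
    are genuine. *)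
Lemma coprime_mul_eq a b x y : 0 < b -> coprime a b -> x * a = y * b ->
  exists k, x = k * b /\ y = k * a.
Proof.
move=> hb hcop e.
have /dvdnP[k ek] : b %| x.
  by rewrite -(@Gauss_dvdl _ _ a) 1?coprime_sym // e dvdn_mull.
by exists k; split=> //; move: e; rewrite ek; nia.
Qed.

(** * General facts on the terms of an Ulam sequence *)

Section UlamTerms.

Variables (a b : nat) (u : nat -> nat).
Hypotheses (ha : 0 < a) (hb : 0 < b) (hab : a <> b) (hu : is_ulam a b u).

Lemma ulam_ltn i j : i < j -> u i < u j.
Proof.
case: hu => u0 u1 hn ij.
case: (ltnP 1 j) => [j2 | j1]; first by have [[lt _] _] := hn j j2; exact: lt.
have [-> ->] : i = 0 /\ j = 1 by lia.
by rewrite u0 u1; lia.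
Qed.

Lemma ulam_leq i j : i <= j -> u i <= u j.
Proof. by rewrite leq_eqVlt => /orP[/eqP-> // | /ulam_ltn/ltnW]. Qed.

Lemma ulam_index_leq n : n <= u n.
Proof.
by elim: n => // n IH; exact: leq_ltn_trans IH (ulam_ltn (ltnSn n)).
Qed.

Lemma is_term_min_or_ge m : is_term u m -> m = minn a b \/ maxn a b <= m.
Proof.
case: hu => u0 u1 _ [[|n] <-]; first by left.
by right; rewrite -u1; exact: ulam_leq.
Qed.

Lemma is_term_gt0 m : is_term u m -> 0 < m.
Proof. by move/is_term_min_or_ge; lia. Qed.

Lemma is_term_generators : is_term u a /\ is_term u b.
Proof.
case: hu => u0 u1 _.
by case: (leqP a b) => le; split; [exists 0 | exists 1 | exists 1 | exists 0];
  rewrite ?u0 ?u1; lia.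
Qed.

Lemma is_term_split n : 2 <= n ->
  exists i j, [/\ i < j, j < n & u i + u j = u n].
Proof.
case: hu => _ _ hn /hn[[_ /eqP/cards1P[[i j] e]] _].
have : (i, j) \in [set (i, j)] by rewrite inE.
rewrite -e inE /= => /andP[ij /eqP s].
by exists i, j; split.
Qed.

Lemma is_term_decomp m : is_term u m -> m <> a -> m <> b ->
  exists s t, [/\ is_term u s, is_term u t, s <> t & s + t = m].
Proof.
case: hu => u0 u1 _ [n <-] na nb.
have n2 : 2 <= n.
  by case: n na nb => [|[|n]] //; rewrite ?u0 ?u1; lia.
have [i [j [ij _ e]]] := is_term_split n2.
exists (u i), (u j); split=> //; [by exists i | by exists j |].
by have := ulam_ltn ij; lia.
Qed.

Lemma is_term_combination m : is_term u m -> exists x y, m = x * a + y * b.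
Proof.
case=> n <-; elim/ltn_ind: n => n IH; case: hu => u0 u1 _.
case: (ltnP 1 n) => [n2 | n1].
  have [i [j [ij jn <-]]] := is_term_split n2.
  have [x1 [y1 ->]] := IH i (ltn_trans ij jn).
  have [x2 [y2 ->]] := IH j jn.
  by exists (x1 + x2), (y1 + y2); lia.
have : u n = a \/ u n = b by case: n n1 {IH} => [|[|]] // _; lia.
by case=> ->; [exists 1, 0 | exists 0, 1]; lia.
Qed.

(** At the first index [n] with [s + t <= u n], the earlier terms are exactly those below [s + t].
    Hence [s + t] is a candidate at [n], and the minimality of [u n] forces equality. *)
Lemma is_term_unique_sum s t : is_term u s -> is_term u t -> s < t ->
  (forall s' t', is_term u s' -> is_term u t' -> s' < t' ->
     s' + t' = s + t -> s' = s) ->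
  is_term u (s + t).
Proof.
move=> [i ui] [j uj] st uniq; case: (hu) => u0 u1 hn.
have ex : exists n, s + t <= u n by exists (s + t); exact: ulam_index_leq.
case: (ex_minnP ex) => n hge hmin.
have below k : (k < n) = (u k < s + t).
  apply/idP/idP => [kn | lt].
    by rewrite ltnNge; apply/negP => /hmin; lia.
  by rewrite ltnNge; apply/negP => /ulam_leq; lia.
have s0 : 0 < s by apply: is_term_gt0; exists i.
have hin : i < n by rewrite below; lia.
have hjn : j < n by rewrite below; lia.
have inj p q : u p = u q -> p = q.
  by case: (ltngtP p q) => // /ulam_ltn; lia.
have ij : i < j by rewrite ltnNge; apply/negP => /ulam_leq; lia.
have [_ le] := hn n ltac:(lia).
exists n; apply/eqP; rewrite eqn_leq hge andbT; apply: le; split.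
  by move=> k; rewrite below.
apply/eqP/cards1P; exists (Ordinal hin, Ordinal hjn).
apply/setP=> -[p q]; rewrite !inE /= xpair_eqE -!val_eqE /=.
apply/andP/andP => [[pq /eqP e] | [/eqP-> /eqP->]]; last first.
  by rewrite ij ui uj.
have es : u p = s.
  by apply: (uniq _ (u q)) => //; [exists p | exists q | exact: ulam_ltn].
by split; apply/eqP; apply: inj; lia.
Qed.

End UlamTerms.

(** * Multiples of a generator that are not terms *)

(** Strong induction on [y]: since [y < a], both summands of [y * b] are multiples of [b]. By
    induction each must be [b] itself, so they are not distinct. *)
Lemma mul_not_term a b u y : 0 < a -> 0 < b -> a <> b -> coprime a b ->
  is_ulam a b u -> 2 <= y < a -> ~ is_term u (y * b).
Proof.
move=> ha hb hab hcop hu; elim/ltn_ind: y => y IH /andP[y_gt1 ya] ty.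
have ya_neq : y * b <> a.
  move=> e; have := coprime_mul_eq (x := 1) hb hcop.
  rewrite mul1n => /(_ y (esym e)) [k [/esym/eqP + e2]].
  by rewrite muln_eq1 => /andP[/eqP k1 _]; move: ya; rewrite e2 k1 mul1n ltnn.
have [|s [t [ts tt st e]]] := is_term_decomp ha hb hab hu ty ya_neq; first nia.
have [x1 [y1 es]] := is_term_combination ha hb hab hu ts.
have [x2 [y2 et]] := is_term_combination ha hb hab hu tt.
have s0 := is_term_gt0 ha hb hab hu ts; have t0 := is_term_gt0 ha hb hab hu tt.
have [k [ex ey]] : exists k, x1 + x2 = k * b /\ y - (y1 + y2) = k * a.
  by apply: coprime_mul_eq => //; rewrite mulnBl; nia.
(* Here [k * a] is at most [y], which is less than [a]. *)
have k0 : k = 0 by nia.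
have [x10 x20] : x1 = 0 /\ x2 = 0 by lia.
move: es et s0 t0; rewrite x10 x20 !mul0n !add0n => es et.
rewrite es et !muln_gt0 => /andP[y10 _] /andP[y20 _].
have ey12 : y1 + y2 = y by nia.
have y11 : y1 = 1.
  case: (ltnP 1 y1) => [y1_gt | ]; last by lia.
  by case: (IH y1); rewrite -?es //; lia.
have y21 : y2 = 1.
  case: (ltnP 1 y2) => [y2_gt | ]; last by lia.
  by case: (IH y2); rewrite -?et //; lia.
by apply: st; rewrite es et y11 y21.
Qed.

Lemma product_not_term a b u : 1 < a -> 1 < b -> a <> b -> coprime a b ->
  is_ulam a b u -> ~ is_term u (a * b).
Proof.
move=> a1 b1 hab hcop hu tab; have ha := ltnW a1; have hb := ltnW b1.
have [||s [t [ts tt st e]]] := is_term_decomp ha hb hab hu tab; [nia | nia |].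
have [x1 [y1 es]] := is_term_combination ha hb hab hu ts.
have [x2 [y2 et]] := is_term_combination ha hb hab hu tt.
have s0 := is_term_gt0 ha hb hab hu ts; have t0 := is_term_gt0 ha hb hab hu tt.
have noB y : 2 <= y < a -> ~ is_term u (y * b) by exact: mul_not_term.
have noA x : 2 <= x < b -> ~ is_term u (x * a).
  apply: mul_not_term => //; [by move/esym | by rewrite coprime_sym |].
  exact: is_ulam_sym.
have [k [ex ey]] : exists k, x1 + x2 = k * b /\ a - (y1 + y2) = k * a.
  by apply: coprime_mul_eq => //; rewrite mulnBl; nia.
(* The summands are both multiples of [b] ([k = 0]) or both multiples of [a] ([k = 1]). Either way
   [mul_not_term] leaves only two equal summands. *)
have : k = 0 \/ k = 1 by nia.
case=> ek; move: ex ey; rewrite ek ?mul0n ?mul1n => ex ey.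
  have [x10 x20] : x1 = 0 /\ x2 = 0 by lia.
  move: es et; rewrite x10 x20 !mul0n !add0n => es et.
  have y12 : y1 + y2 = a by nia.
  have [y10 y20] : 0 < y1 /\ 0 < y2 by nia.
  have n1 : ~ (2 <= y1 < a) by move=> /noB; rewrite -es.
  have n2 : ~ (2 <= y2 < a) by move=> /noB; rewrite -et.
  have [e1 e2] : y1 = 1 /\ y2 = 1 by lia.
  by apply: st; rewrite es et e1 e2.
have [y10 y20] : y1 = 0 /\ y2 = 0 by lia.
move: es et; rewrite y10 y20 !mul0n !addn0 => es et.
have [x10 x20] : 0 < x1 /\ 0 < x2 by nia.
have n1 : ~ (2 <= x1 < b) by move=> /noA; rewrite -es.
have n2 : ~ (2 <= x2 < b) by move=> /noA; rewrite -et.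
have [e1 e2] : x1 = 1 /\ x2 = 1 by lia.
by apply: st; rewrite es et e1 e2.
Qed.

(** * The terms [a + n * b] and the count of the even ones *)

Lemma decomp_uses_b a b u n s t : 1 < a -> 0 < b -> a <> b -> coprime a b ->
  is_ulam a b u -> n <= a -> is_term u s -> is_term u t -> s <> t ->
  s + t = a + n * b -> s = b \/ t = b.
Proof.
move=> a1 hb hab hcop hu na ts tt st e; have ha := ltnW a1.
case: (ltnP 1 b) => [b1 | b1]; last first.
  have := is_term_min_or_ge ha hb hab hu ts.
  by have := is_term_min_or_ge ha hb hab hu tt; nia.
have s0 := is_term_gt0 ha hb hab hu ts; have t0 := is_term_gt0 ha hb hab hu tt.
have noB y : 2 <= y <= a -> ~ is_term u (y * b).
  case/andP=> y2; rewrite leq_eqVlt => /orP[/eqP-> | ya].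
    exact: product_not_term.
  by apply: (mul_not_term (a := a)) => //; apply/andP.
have noA x : 2 <= x <= b -> ~ is_term u (x * a).
  case/andP=> x2; rewrite leq_eqVlt => /orP[/eqP-> | xb].
    by rewrite mulnC; exact: product_not_term.
  apply: (mul_not_term (a := b)) => //; last by apply/andP.
  - by move/esym.
  - by rewrite coprime_sym.
  exact: is_ulam_sym.
have [x1 [y1 es]] := is_term_combination ha hb hab hu ts.
have [x2 [y2 et]] := is_term_combination ha hb hab hu tt.
have eXY : (x1 + x2) * a + (y1 + y2) * b = a + n * b by rewrite -e es et; lia.
(* Otherwise [b] would divide [a], contradicting coprimality as [b > 1]. This makes the subtraction
   of 1 below a genuine one. *)
have X0 : 0 < x1 + x2.
  rewrite lt0n; apply/eqP => X0.
  have [|k [ex _]] := @coprime_mul_eq a b 1 (y1 + y2 - n) hb hcop.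
    by rewrite mulnBl; nia.
  by move/esym/eqP: ex; rewrite muln_eq1; lia.
have [k [ex ey]] : exists k, x1 + x2 - 1 = k * b /\ n - (y1 + y2) = k * a.
  by apply: coprime_mul_eq => //; rewrite !mulnBl; nia.
have : k = 0 \/ k = 1 by nia.
case=> ek; move: ex ey; rewrite ek ?mul0n ?mul1n => ex ey.
  (* One summand contains no [a]; it is a multiple of [b] with coefficient at most [n <= a], hence
     [b] itself by [noB]. *)
  have X1 : x1 + x2 = 1 by lia.
  have Yn : y1 + y2 = n by nia.
  have [x10 | x20] : x1 = 0 \/ x2 = 0 by lia.
    left; move: es; rewrite x10 mul0n add0n => es.
    have n1 : ~ (2 <= y1 <= a) by move=> /noB; rewrite -es.
    have y11 : y1 = 1 by nia.
    by rewrite es y11 mul1n.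
  right; move: et; rewrite x20 mul0n add0n => et.
  have n2 : ~ (2 <= y2 <= a) by move=> /noB; rewrite -et.
  have y21 : y2 = 1 by nia.
  by rewrite et y21 mul1n.
(* Now [n = a] and the sum is [(b + 1) * a]. Both coefficients lie between 1 and [b], so [noA] makes
   them 1, which contradicts [b > 1]. *)
have [y10 y20] : y1 = 0 /\ y2 = 0 by lia.
move: es et; rewrite y10 y20 !mul0n !addn0 => es et.
have [x10 x20] : 0 < x1 /\ 0 < x2 by nia.
have n1 : ~ (2 <= x1 <= b) by move=> /noA; rewrite -es.
have n2 : ~ (2 <= x2 <= b) by move=> /noA; rewrite -et.
by lia.
Qed.

Lemma add_mul_is_term a b u n : 1 < a -> 0 < b -> a <> b -> coprime a b ->
  is_ulam a b u -> n <= a -> is_term u (a + n * b).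
Proof.
move=> a1 hb hab hcop hu; have ha := ltnW a1.
have [ta tb] := is_term_generators ha hb hab hu.
elim: n => [|n IH] na; first by rewrite mul0n addn0.
have tn := IH (ltnW na).
have neq : b <> a + n * b by case: (n) => [|k]; rewrite ?mulSn; lia.
have uniq s t : is_term u s -> is_term u t -> s < t ->
    s + t = a + n.+1 * b -> s = b \/ t = b.
  by move=> ts tt st; apply: (decomp_uses_b (a := a) (u := u)) => //; lia.
(* The criterion wants ordered summands, and for [n = 0] either of [a] and [b] may be the
   smaller. *)
have -> : a + n.+1 * b = minn b (a + n * b) + maxn b (a + n * b) by lia.
have tmin : is_term u (minn b (a + n * b)) by rewrite /minn; case: ifP.
have tmax : is_term u (maxn b (a + n * b)) by rewrite /maxn; case: ifP.
apply: (is_term_unique_sum ha hb hab hu) => //; first lia.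
move=> s t ts tt st e; have e' : s + t = a + n.+1 * b by lia.
by have := uniq s t ts tt st e'; lia.
Qed.

Lemma even_generator_bound a b u : 0 < a -> 0 < b -> a <> b -> coprime a b ->
  is_ulam a b u -> ~~ odd a -> at_least_even_terms u (1 + a %/ 2).
Proof.
move=> ha hb hab hcop hu ev; have a1 : 1 < a by lia.
(* A term is at least its index, so every term up to [a + a * b] has its index below [N]. *)
pose N := (a + a * b).+1; exists N.
pose A := [set i : 'I_N | ~~ odd (u i)].
pose s := [seq a + j.*2 * b | j <- iota 0 (1 + a %/ 2)].
have -> : 1 + a %/ 2 = size s by rewrite size_map size_iota.
have -> : #|A| = size [seq u (val i) | i <- enum A] by rewrite size_map -cardE.
(* The indices in [A] are counted through their values: the duplicate-free list [s] is contained in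
   the list of values of [u] on [A]. *)
apply: uniq_leq_size.
  by rewrite map_inj_uniq ?iota_uniq // => i j; nia.
move=> m /mapP[j]; rewrite mem_iota => /andP[_ hj] ->.
have ja : j.*2 <= a by lia.
have [i ui] := add_mul_is_term a1 hb hab hcop hu ja.
have iN : i < N.
  rewrite ltnS (leq_trans (ulam_index_leq ha hb hab hu i)) // ui.
  by rewrite leq_add2l leq_mul2r ja orbT.
apply/mapP; exists (Ordinal iN) => //.
by rewrite mem_enum inE /= ui oddD oddM odd_double (negbTE ev).
Qed.

Theorem theorem1p6 (a b : nat) (ha : 0 < a) (hb : 0 < b) (hab : a <> b)
    (hcop : coprime a b) (heven : ~~ odd a \/ ~~ odd b)
    (u : nat -> nat) (hu : is_ulam a b u) :
  (~~ odd a -> at_least_even_terms u (1 + a %/ 2)) /\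
  (~~ odd b -> at_least_even_terms u (1 + b %/ 2)).
Proof.
split; first exact: even_generator_bound hu.
apply: even_generator_bound (is_ulam_sym hu) => //; first by move/esym.
by rewrite coprime_sym.
Qed.
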